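(* Let $p\ge 1$ and let $\{\lambda^{(j)}_k\}_{k=1}^\infty$, $j=1,\dots,p$, be non-decreasing sequences of positive real numbers, with counting functions $N_j$, and let $N$ be the counting function of the $p$-fold products. Suppose that there are non-negative numbers $\tau<\alpha$ and (distinct) indices $j_1,\dots,j_\nu\in\{1,\dots,p\}$, where $1\le\nu\le p$, such that $$N_{j_q}(\lambda)\sim A_{j_q}\lambda^{\alpha},\quad \lambda\to\infty,\quad q=1,\dots,\nu,$$ with $A_{j_q}\ne 0$, and $$N_j(\lambda)=O(\lambda^{\tau}),\quad \lambda\to\infty,\quad j\notin\{j_1,\dots,j_\nu\}.$$ Then $$N(\lambda)\sim A\,\lambda^{\alpha}\,\frac{(\alpha\log\lambda)^{\nu-1}}{(\nu-1)!},\quad \lambda\to\infty,$$ where $$A=\left(\prod_{q=1}^{\nu}A_{j_q}\right)\cdot\left(\prod_{j\notin\{j_1,\dots,j_\nu\}}\left(\sum_{k=1}^\infty\frac{1}{(\lambda^{(j)}_k)^{\alpha}}\right)\right).$$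
   Context: $N_j(\lambda)=\#\{k\in\mathbb{N}:\lambda^{(j)}_k\le\lambda\}$ for $j=1,\dots,p$, and $N(\lambda)=\#\{(k_1,\dots,k_p)\in\mathbb{N}^p:\lambda^{(1)}_{k_1}\lambda^{(2)}_{k_2}\cdots\lambda^{(p)}_{k_p}\le\lambda\}$, where here $\mathbb{N}=\{1,2,\dots\}$ indexes the sequences. Empty products equal $1$. $f\sim g$ means $f/g\to1$. *)

(* Defs.v *)
From HB Require Import structures.
From mathcomp Require Export all_boot all_order all_algebra.
From mathcomp Require Export all_classical all_reals all_analysis.

Set Implicit Arguments.
Unset Strict Implicit.
Unset Printing Implicit Defensive.

Export Order.TTheory GRing.Theory Num.Theory.
Export numFieldNormedType.Exports.

Local Open Scope classical_set_scope.
Local Open Scope ring_scope.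

(* Counting functions take values in the extended reals: the value is +oo when
   the set that is counted is infinite. The sequences are indexed by nat, so
   [lam k] is the term that is usually written with index k + 1. *)
Definition counting_fun (R : realType) (lam : nat -> R) (x : R) : \bar R :=
  counting [set k : nat | lam k <= x].

Definition prod_counting_fun (R : realType) (p : nat) (lam : 'I_p -> nat -> R)
    (x : R) : \bar R :=
  counting [set k : {ffun 'I_p -> nat} | \prod_(j < p) lam j (k j) <= x].

(* The quotient is taken in the extended reals. Since +oo / c = +oo for c > 0
   and c / +oo = 0, the limit 1 forces both functions to be eventually finite
   whenever they are nonnegative. *)
Definition asymp_equiv (R : realType) (f g : R -> \bar R) : Prop :=
  (f x / g x)%E @[x --> +oo] --> 1%E.

(* f = O(g) at +oo; with f extended real valued, it entails f x < +oo for x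
   large. *)
Definition asymp_bigO (R : realType) (f : R -> \bar R) (g : R -> R) : Prop :=
  exists C : R, \forall x \near +oo, (`|f x| <= (C * `|g x|)%:E)%E.

(* Main.v *)
Require Import Defs.
From mathcomp Require Import finmap ring lra.

Set Implicit Arguments.
Unset Strict Implicit.
Unset Printing Implicit Defensive.

(** Replacing every sequence lambda by mu = lambda^alpha and x by x^alpha
    changes neither side, so one may take alpha = 1. For a sequence of indices
    s, let F_s(x) be the number of products, with one factor from each sequence
    indexed in s, that are at most x. Sorting these products according to the
    value of one chosen factor gives, when a sequence mu is added to s,
      F_{mu :: s}(x) = sum_k F_s(x / mu_k),
    a finite sum since F_s vanishes near 0. The theorem follows by induction on
    s, from a sequence with N_j(x) ~ A_j x as the base case: if
    F(x) ~ B x (log x)^m and G(x) = sum_k F(x / mu_k), then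

    - if the counting function of mu is ~ A x, then
        G(x) ~ (A B / (m + 1)) x (log x)^(m+1)       [cvg_add_regular];
    - if sum_k 1 / mu_k = S is finite, then
        G(x) ~ B S x (log x)^m                       [cvg_add_summable].

    The second fact is dominated convergence for series [tannery], with
    dominating terms proportional to 1 / mu_k. For the first, F may be replaced
    by B y (log y)^m on y >= 1 up to errors of smaller order, so it remains to
    estimate
      sum_{mu_k <= x} (1 / mu_k) (log x - log mu_k)^m      [cvg_log_sum].
    Since k / mu_k -> A, the Stolz-Cesaro theorem gives the moments
      sum_{k < n} (log mu_k)^i / mu_k ~ A (log n)^(i+1) / (i + 1)
                                                           [cvg_moments],
    and expanding the power binomially leaves the identity
      sum_i (-1)^i C(m, i) / (i + 1) = 1 / (m + 1).

    A sequence with N_j(x) = O(x^tau) falls under the second case, because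
    lambda_k^tau is then at least a constant times k, whence
    lambda_k^(-alpha) = O(k^(-alpha / tau)) with alpha / tau > 1
    [cvg_series_powR_counted]. *)

Local Open Scope classical_set_scope.
Local Open Scope ring_scope.

(** * Limits of quotients of sums and of dominated series *)

Lemma cvgXn (R : realType) (T : Type) (F : set_system T) {FF : Filter F}
    (f : T -> R) (l : R) (n : nat) :
  f @ F --> l -> (fun x => f x ^+ n) @ F --> l ^+ n.
Proof.
move=> fl.
by apply: (cvg_comp _ (fun x : R => x ^+ n) fl); exact: exprn_continuous.
Qed.

Arguments cvgXn {R T F FF f l} n _.

(** The Stolz-Cesaro theorem, in terms of increments. *)
Lemma stolz_cesaro (R : realType) (a b : nat -> R) (l : R) :
  (forall k, 0 < b k) ->
  (fun n => \sum_(0 <= k < n) b k) @ \oo --> +oo ->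
  (fun k => a k / b k) @ \oo --> l ->
  (fun n => (\sum_(0 <= k < n) a k) / (\sum_(0 <= k < n) b k)) @ \oo --> l.
Proof.
move=> b0 Sb abl; apply/cvgrPdist_le => e e0.
have e20 : 0 < e / 2 by rewrite divr_gt0.
have [K _ HK] : \forall k \near \oo, `|l - a k / b k| <= e / 2.
  by move/cvgrPdist_le : abl => /(_ _ e20).
pose C := \sum_(0 <= k < K) `|l * b k - a k|.
near=> n.
have Kn : (K <= n)%N by near: n; exists K.
have Sn0 : 0 < \sum_(0 <= k < n) b k.
  by near: n; exact: (cvgry_gt Sb).
have CSn : C <= e / 2 * \sum_(0 <= k < n) b k.
  rewrite mulrC -ler_pdivrMr//; near: n; exact: (cvgry_ge Sb).
rewrite -[l](mulfK (lt0r_neq0 Sn0)) -mulrBl normrM normfV.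
rewrite (gtr0_norm Sn0) ler_pdivrMr// mulr_sumr -sumrB.
apply: le_trans (ler_norm_sum _ _ _) _.
rewrite (@big_cat_nat _ _ _ K)//= [e]splitr mulrDl lerD//.
rewrite [X in _ <= _ * X](@big_cat_nat _ _ _ K)//= mulrDr mulr_sumr.
rewrite [leRHS]addrC -[leLHS]addr0 lerD//; last first.
  by apply: sumr_ge0 => k _; rewrite mulr_ge0 ?ltW.
rewrite mulr_sumr; apply: ler_sum_nat => k /andP[Kk _].
rewrite -ler_pdivrMr//; apply: le_trans (HK _ Kk).
rewrite -[X in _ / X]gtr0_norm// -normfV -normrM mulrBl mulfK//.
exact: lt0r_neq0.
Unshelve. all: by end_near. Qed.

(** Tannery's theorem: dominated convergence for series. The hypothesis on [g]
    says that the series [f k x] has finitely many nonzero terms and sum [g x]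
    for [x] close to the limit. *)
Lemma tannery (R : realType) (T : Type) (F : set_system T) {FF : Filter F}
    (f : nat -> T -> R) (g : T -> R) (a M : nat -> R) (s : R) :
  (forall k, f k @ F --> a k) ->
  (\forall x \near F, forall k, `|f k x| <= M k) ->
  cvgn (series M) -> (forall k, `|a k| <= M k) ->
  series a @ \oo --> s ->
  (\forall x \near F, \forall n \near \oo, g x = \sum_(0 <= k < n) f k x) ->
  g @ F --> s.
Proof.
move=> fa fM cM aM sa gf; apply/cvgrPdist_le => e e0.
have e40 : 0 < e / 4 by rewrite divr_gt0.
have M0 k : 0 <= M k by apply: le_trans (aM k).
have tail : \forall K \near \oo, forall n, (K <= n)%N ->
    \sum_(K <= k < n) M k <= e / 4.
  have := cM => /cvgrPdist_le/(_ _ e40) H; near=> K => n Kn.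
  have : `|limn (series M) - series M K| <= e / 4 by near: K.
  have : series M n <= limn (series M).
    apply: nondecreasing_cvgn_le => //.
    by apply/nondecreasing_seqP => k; rewrite /series/= big_nat_recr//= lerDl.
  rewrite -(sub_series_geq _ Kn).
  move=> h1 h2; apply: le_trans h2; apply: le_trans (ler_norm _).
  by rewrite lerB.
have [K _ HK] := tail.
have sK : `|s - \sum_(0 <= k < K) a k| <= e / 4 + e / 4.
  have [n [/= sn Kn]] : exists n,
      `|s - \sum_(0 <= k < n) a k| <= e / 4 /\ (K <= n)%N.
    near \oo => n; exists n; split; last by near: n; exists K.
    by near: n; have /cvgrPdist_le/(_ _ e40) := sa.
  rewrite -(subrKA (\sum_(0 <= k < n) a k)).
  apply: le_trans (ler_normD _ _) _; rewrite lerD//.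
  rewrite (@big_cat_nat _ _ _ K 0 n)//= [X in `|X|]addrAC subrr add0r.
  apply: le_trans (ler_norm_sum _ _ _) _.
  by apply: le_trans (HK _ (leqnn K) _ Kn); apply: ler_sum.
have fK : (fun x => \sum_(0 <= k < K) f k x) @ F --> \sum_(0 <= k < K) a k.
  by apply: cvg_big => //; exact: add_continuous.
near=> x.
have [N _ HN] : \forall n \near \oo, g x = \sum_(0 <= k < n) f k x by near: x.
have {HN}gx := HN (maxn K N) (leq_maxr _ _).
have fMx : forall k, `|f k x| <= M k by near: x.
have fKx : `|\sum_(0 <= k < K) a k - \sum_(0 <= k < K) f k x| <= e / 4.
  by near: x; move/cvgrPdist_le : fK => /(_ _ e40).
have gK : `|\sum_(0 <= k < K) f k x - g x| <= e / 4.
  rewrite gx (@big_cat_nat _ _ _ K 0 (maxn K N))//= ?leq_maxl// opprD addNKr normrN.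
  apply: le_trans (ler_norm_sum _ _ _) _.
  by apply: le_trans (HK _ (leqnn K) _ (leq_maxl K N)); apply: ler_sum.
move: sK fKx gK; set A := \sum_(0 <= k < K) a k; set B := \sum_(0 <= k < K) f k x.
rewrite !ler_norml => /andP[? ?] /andP[? ?] /andP[? ?]; apply/andP; split; lra.
Unshelve. all: by end_near. Qed.

(** * Logarithms and their moments along a sequence *)

Lemma cvg_ln_pinfty (R : realType) : @ln R x @[x --> +oo] --> +oo.
Proof.
apply/cvgryPge => A; near=> x.
have x0 : 0 < x by near: x; apply: nbhs_pinfty_gt; exact: num_real.
by rewrite -[A]expRK ler_ln ?posrE ?expR_gt0.
Unshelve. all: by end_near. Qed.

Lemma cvgyV (R : realType) (T : Type) (F : set_system T) {FF : Filter F}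
    (f : T -> R) :
  f @ F --> +oo -> (fun x => (f x)^-1) @ F --> 0.
Proof. by move=> fy; apply/gtr0_cvgV0 => //; exact: cvgry_gt. Qed.

(** Functions of the same order of growth have equivalent logarithms. *)
Lemma cvg_ln_ratio (R : realType) (T : Type) (F : set_system T)
    {FF : Filter F} (f g : T -> R) (a : R) :
  0 < a -> g @ F --> +oo -> (fun x => f x / g x) @ F --> a ->
  (fun x => ln (f x) / ln (g x)) @ F --> (1 : R).
Proof.
move=> a0 gy fg.
have lng : (fun x => ln (g x)) @ F --> +oo.
  by apply: (cvg_comp _ _ gy); exact: cvg_ln_pinfty.
have lnfg : (fun x => ln (f x / g x)) @ F --> ln a.
  by apply: (cvg_comp _ _ fg); exact: continuous_ln.
have : (fun x => 1 + ln (f x / g x) * (ln (g x))^-1) @ F --> 1 + ln a * 0.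
  apply: cvgD; first exact: cvg_cst.
  apply: cvgM => //; exact: cvgyV.
rewrite mulr0 addr0; apply: cvg_trans; apply: near_eq_cvg; near=> x.
have gx : 0 < g x by near: x; exact: cvgry_gt.
have lgx : 0 < ln (g x) by near: x; exact: (cvgry_gt lng).
have fgx : 0 < f x / g x by near: x; exact: (cvgr_gt _ fg).
rewrite ln_div ?posrE//; last by move: fgx; rewrite pmulr_lgt0// invr_gt0.
by rewrite mulrBl divff ?gt_eqF// addrCA subrr addr0.
Unshelve. all: by end_near. Qed.

Lemma cvg_ln_dilation (R : realType) (a : R) : 0 < a ->
  (fun x : R => ln (x / a) / ln x) @ +oo --> (1 : R).
Proof.
move=> a0; apply: (@cvg_ln_ratio _ _ _ _ (fun x => x / a) id a^-1).
- by rewrite invr_gt0.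
- exact: cvg_id.
- have : (fun=> a^-1 : R) @ (+oo : set_system R) --> a^-1 by exact: cvg_cst.
  apply: cvg_trans; apply: near_eq_cvg; near=> x.
  have x0 : 0 < x by near: x; apply: nbhs_pinfty_gt; exact: num_real.
  by rewrite /= mulrAC divff ?mul1r// gt_eqF.
Unshelve. all: by end_near. Qed.

Lemma cvg_succ_ratio (R : realType) :
  (fun k => k.+2%:R / k.+1%:R : R) @ \oo --> (1 : R).
Proof.
have : (fun k => 1 + @harmonic R k) @ \oo --> (1 : R) + 0.
  by apply: cvgD; [exact: cvg_cst|exact: cvg_harmonic].
rewrite addr0; apply: cvg_trans; apply: near_eq_cvg; near=> k.
by rewrite /harmonic/= -[in RHS]natr1 mulrDl mul1r divff// addrC.
Unshelve. all: by end_near. Qed.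

Lemma cvg_natS (R : realType) : (fun k => k.+1%:R : R) @ \oo --> +oo.
Proof.
apply/cvgryPge => A; near=> k; apply: le_trans (_ : k%:R <= _); last by rewrite ler_nat.
by near: k; apply: cvgry_ge; exact: cvgr_idn.
Unshelve. all: by end_near. Qed.

Lemma ln_succ_bounds (R : realType) (k : nat) :
  (k.+2%:R)^-1 <= ln (k.+2%:R : R) - ln k.+1%:R <= (k.+1%:R)^-1.
Proof.
rewrite -ln_div ?posrE ?ltr0n//.
apply/andP; split.
  rewrite -[X in ln X]invrK lnV ?posrE ?invr_gt0 ?divr_gt0// invf_div.
  rewrite lerNr -[k.+1%:R](addrK 1) natr1 mulrBl divff// mul1r.
  by rewrite le_ln1Dx// ltrN2 invf_lt1// ltr1n.
rewrite -natr1 mulrDl mul1r divff// le_ln1Dx//.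
by apply: lt_trans (_ : 0 < _); rewrite ?invr_gt0// ltrN10.
Qed.

(** Stolz-Cesaro against the increments of [ln k.+1 ^+ i.+1]. *)
Lemma cvg_moments (R : realType) (mu : nat -> R) (A : R) (i : nat) :
  (forall k, 0 < mu k) -> 0 < A ->
  (fun k => k.+1%:R / mu k) @ \oo --> A ->
  (fun n => (\sum_(0 <= k < n) ln (mu k) ^+ i / mu k) / ln (n.+1%:R) ^+ i.+1)
    @ \oo --> A / i.+1%:R.
Proof.
move=> mu0 A0 muA.
pose u (k : nat) : R := ln k.+1%:R.
pose b k := u k.+1 ^+ i.+1 - u k ^+ i.+1.
have uy : u @ \oo --> +oo.
  by apply: (cvg_comp _ _ (@cvg_natS R)); exact: cvg_ln_pinfty.
have u0 k : 0 <= u k by rewrite ln_ge0// ler1n.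
have du k : u k < u k.+1 by rewrite ltr_ln ?posrE// ltr_nat.
have b0 k : 0 < b k by rewrite subr_gt0 ltrXn2r.
have Sb n : \sum_(0 <= k < n) b k = u n ^+ i.+1.
  by rewrite telescope_sumr// /u ln1 expr0n subr0.
under eq_fun => n do rewrite -[ln n.+1%:R ^+ i.+1]Sb.
apply: stolz_cesaro => //.
  under eq_fun do rewrite Sb.
  apply/cvgryPge => M; near=> n.
  have u1 : 1 <= u n by near: n; exact: (cvgry_ge uy).
  apply: le_trans (_ : u n <= _); first by near: n; exact: (cvgry_ge uy).
  by rewrite -[leLHS]expr1 ler_weXn2l.
have cu : (fun k => u k.+1 / u k) @ \oo --> (1 : R).
  apply: (@cvg_ln_ratio _ _ _ _ (fun k => k.+2%:R) (fun k => k.+1%:R) 1) => //.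
    exact: cvg_natS.
  exact: cvg_succ_ratio.
have cmu : (fun k => ln (mu k) / u k) @ \oo --> (1 : R).
  apply: (@cvg_ln_ratio _ _ _ _ mu (fun k => k.+1%:R) A^-1).
  - by rewrite invr_gt0.
  - exact: cvg_natS.
  - have : (fun k => (k.+1%:R / mu k)^-1) @ \oo --> A^-1.
      by apply: cvgV => //; exact: lt0r_neq0.
    apply: cvg_trans.
    by apply: near_eq_cvg; near=> k; rewrite /= invf_div.
have cdu : (fun k => k.+1%:R * (u k.+1 - u k)) @ \oo --> (1 : R).
  apply: (@squeeze_cvgr _ _ _ _ (fun k => (k.+2%:R / k.+1%:R)^-1) (fun=> 1)).
  - near=> k; have /andP[h1 h2] := @ln_succ_bounds R k.
    by rewrite invf_div ler_pM2l//= h1/= mulrC -ler_pdivlMr// mul1r.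
  - rewrite -[X in _ --> X]invr1; apply: cvgV => //; exact: cvg_succ_ratio.
  - exact: cvg_cst.
(* The quotient [ln (mu k) ^+ i / mu k / b k], after factoring the difference of
   powers [b k] and dividing through by [u k ^+ i / k.+1]. *)
have : (fun k => (ln (mu k) / u k) ^+ i * (k.+1%:R / mu k) *
    ((k.+1%:R * (u k.+1 - u k)) * \sum_(j < i.+1) (u k.+1 / u k) ^+ (i - j))^-1)
   @ \oo --> 1 ^+ i * A * (1 * \sum_(j < i.+1) 1 ^+ (i - j))^-1.
  apply: cvgM.
    by apply: cvgM => //; exact: cvgXn.
  apply: cvgV.
    rewrite mul1r; under eq_bigr do rewrite expr1n.
    by rewrite sumr_const card_ord.
  apply: cvgM => //.
  apply: cvg_big => [|j _]; first exact: add_continuous.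
  exact: cvgXn.
rewrite expr1n !mul1r; under eq_bigr do rewrite expr1n.
rewrite sumr_const card_ord.
apply: cvg_trans; apply: near_eq_cvg; near=> k.
have uk : 0 < u k by near: k; exact: (cvgry_gt uy).
rewrite /b subrXX.
have -> : \sum_(j < i.+1) u k.+1 ^+ (i.+1.-1 - j) * u k ^+ j =
    u k ^+ i * \sum_(j < i.+1) (u k.+1 / u k) ^+ (i - j).
  rewrite mulr_sumr; apply: eq_bigr => j _ /=.
  rewrite expr_div_n mulrCA; congr (_ * _).
  have ji : (j <= i)%N by rewrite -ltnS.
  by rewrite -{2}(subnK ji) exprD mulrAC mulfV ?mul1r// expf_neq0// gt_eqF.
set S := \sum_(_ < _) _; set d := u k.+1 - u k.
have d0 : d != 0 by rewrite subr_eq0 gt_eqF.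
have S0 : S != 0.
  rewrite gt_eqF// /S big_ord_recr/= subnn expr0 ltr_wpDl//.
  by apply: sumr_ge0 => j _; rewrite exprn_ge0// divr_ge0.
have u0' : u k ^+ i != 0 by rewrite expf_neq0// gt_eqF.
have mk0 := lt0r_neq0 (mu0 k).
rewrite expr_div_n; field.
by rewrite S0 d0 u0' mk0 /= addrC natr1.
Unshelve. all: by end_near. Qed.

(** * Counting functions of sequences *)

(** [n x] is the number of terms of [mu] that are at most [x], and these are the
    first [n x] terms. Such an [n] exists exactly when [mu] is nondecreasing and
    unbounded. *)
Definition counted_by (R : realType) (mu : nat -> R) (n : R -> nat) : Prop :=
  forall x k, (k < n x)%N = (mu k <= x).

Section CountedBy.
Variables (R : realType) (mu : nat -> R) (n : R -> nat).
Hypothesis mun : counted_by mu n.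

Lemma counted_by_cvgy : n @ +oo --> \oo.
Proof.
apply/cvgnyPge => N; near=> x; apply: ltnW; rewrite mun.
by near: x; apply: nbhs_pinfty_ge; exact: num_real.
Unshelve. all: by end_near. Qed.

Lemma counted_by_cvgry : mu @ \oo --> +oo.
Proof.
apply/cvgryPge => M; near=> k; apply/ltW; rewrite ltNge -mun -leqNgt.
by near: k; exists (n M).
Unshelve. all: by end_near. Qed.

(** Comparison of [k.+1] with the counting function at [mu k] and at
    [mu k - 1]; several terms of [mu] may equal [mu k]. *)
Lemma counted_by_index_ratio (A : R) :
  (fun x => (n x)%:R / x) @ +oo --> A -> (fun k => k.+1%:R / mu k) @ \oo --> A.
Proof.
move=> nA.
have muy := counted_by_cvgry.
have mu1y : (fun k => mu k - 1) @ \oo --> +oo.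
  apply/cvgryPge => M; near=> k; rewrite lerBrDr.
  by near: k; exact: (cvgry_ge muy).
have hi : (fun k => (n (mu k))%:R / mu k) @ \oo --> A.
  exact: (cvg_comp _ _ muy nA).
have lo : (fun k => (n (mu k - 1))%:R / (mu k - 1) * (1 - (mu k)^-1)) @ \oo --> A * (1 - 0).
  apply: cvgM; first exact: (cvg_comp _ _ mu1y nA).
  by apply: cvgB; [exact: cvg_cst|exact: cvgyV].
rewrite subr0 mulr1 in lo; apply: (squeeze_cvgr _ lo hi).
near=> k.
have mk : 1 < mu k by near: k; exact: (cvgry_gt muy).
have mk0 : 0 < mu k by apply: lt_trans mk.
rewrite (_ : _ / _ * _ = (n (mu k - 1))%:R / mu k); last first.
  by field; rewrite subr_eq0 !gt_eqF.
rewrite !ler_pM2r ?invr_gt0// !ler_nat mun lexx andbT.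
by rewrite leqW// leqNgt mun -ltNge ltrBlDr ltrDl.
Unshelve. all: by end_near. Qed.

Lemma sum_counted_by (f : nat -> R) (x : R) (N : nat) : (n x <= N)%N ->
  \sum_(0 <= k < N) (if mu k <= x then f k else 0) = \sum_(0 <= k < n x) f k.
Proof.
move=> nN; rewrite (@big_cat_nat _ _ _ (n x))//= -[RHS]addr0; congr (_ + _).
  by apply: eq_big_nat => k /andP[_ kn]; rewrite -mun kn.
rewrite big_nat_cond; apply: big1 => k /andP[/andP[nk _] _].
by rewrite -mun ltnNge nk.
Qed.

Lemma sum1_counted_by (x : R) (N : nat) : (n x <= N)%N ->
  \sum_(0 <= k < N) (mu k <= x)%R%:R = (n x)%:R :> R.
Proof.
move=> nN; rewrite -[in RHS](subn0 (n x)) -(sumr_const_nat _ _ 1).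
rewrite -(sum_counted_by (fun=> 1) nN); apply: eq_bigr => k _.
by case: ifP.
Qed.

End CountedBy.

(** * Adding a sequence with counting function equivalent to A x *)

Lemma sum_alternating_bin (R : numFieldType) (m : nat) :
  \sum_(i < m.+1) (-1) ^+ i * 'C(m, i)%:R / i.+1%:R = (m.+1%:R)^-1 :> R.
Proof.
have E (i : nat) : (-1) ^+ i * 'C(m, i)%:R / i.+1%:R =
    (m.+1%:R)^-1 * ((-1) ^+ i * 'C(m.+1, i.+1)%:R) :> R.
  have H : m.+1%:R * 'C(m, i)%:R = i.+1%:R * 'C(m.+1, i.+1)%:R :> R.
    by rewrite -!natrM -mul_bin_diag.
  rewrite mulrCA -mulrA; congr (_ * _); apply: (@mulfI _ m.+1%:R).
    by rewrite pnatr_eq0.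
  by rewrite mulrA H mulrAC mulfV ?pnatr_eq0// mul1r mulrA mulfV ?pnatr_eq0// mul1r.
under eq_bigr do rewrite E.
rewrite -mulr_sumr -[RHS]mulr1; congr (_ * _).
have := exprBn (1 : R) 1 m.+1.
rewrite subrr expr0n big_ord_recl/= bin0 !expr1n mulr1 mulr1n.
move/eqP; rewrite eq_sym addr_eq0 => /eqP; rewrite expr0 mul1r => H.
rewrite [RHS]H -sumrN.
apply: eq_bigr => i _.
rewrite [in RHS]/bump/= add1n !expr1n !mulr1 exprS mulN1r mulNrn opprK.
by rewrite mulr_natr.
Qed.

(** The case where [F] is exactly [y * ln y ^+ m] on [1 <= y]. *)
Lemma cvg_log_sum (R : realType) (mu : nat -> R) (n : R -> nat) (A : R)
    (m : nat) :
  (forall k, 0 < mu k) -> counted_by mu n -> 0 < A ->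
  (fun x => (n x)%:R / x) @ +oo --> A ->
  (fun x => (\sum_(0 <= k < n x) (x / mu k) * ln (x / mu k) ^+ m)
     / (x * ln x ^+ m.+1)) @ +oo --> A / m.+1%:R.
Proof.
move=> mu0 mun A0 nA.
have ny := counted_by_cvgy mun.
have mom (i : nat) :
    (fun x => (\sum_(0 <= k < n x) ln (mu k) ^+ i / mu k) / ln x ^+ i.+1)
      @ +oo --> A / i.+1%:R.
  have h1 : (fun x => (\sum_(0 <= k < n x) ln (mu k) ^+ i / mu k) /
      ln (n x).+1%:R ^+ i.+1) @ +oo --> A / i.+1%:R.
    have h0 := counted_by_index_ratio mun nA.
    exact: (cvg_comp n _ ny (@cvg_moments _ _ _ i mu0 A0 h0)).
  have h2 : (fun x => ln (n x).+1%:R / ln x) @ +oo --> (1 : R).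
    apply: (@cvg_ln_ratio _ _ _ _ (fun x => (n x).+1%:R) id A) => //.
    have : (fun x => (n x)%:R / x + x^-1) @ +oo --> A + 0.
      by apply: cvgD => //; exact: cvgyV.
    rewrite addr0; apply: cvg_trans; apply: near_eq_cvg; near=> x.
    by rewrite -natr1 mulrDl mul1r.
  pose proof (cvgM h1 (cvgXn i.+1 h2)) as h; move: h.
  rewrite expr1n mulr1.
  apply: cvg_trans; apply: near_eq_cvg; near=> x.
  rewrite /= expr_div_n mulrA divfK// expf_neq0// gt_eqF// ln_gt0//.
  by rewrite ltr1n ltnS; near: x; move/cvgnyPgt : ny; exact.
have -> : A / m.+1%:R =
    \sum_(i < m.+1) ((-1) ^+ i * 'C(m, i)%:R) * (A / i.+1%:R).
  rewrite -sum_alternating_bin mulr_sumr; apply: eq_bigr => i _.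
  by rewrite !mulrA; congr (_ / _); rewrite -mulrA mulrC.
have : (fun x => \sum_(i < m.+1) ((-1) ^+ i * 'C(m, i)%:R) *
   ((\sum_(0 <= k < n x) ln (mu k) ^+ i / mu k) / ln x ^+ i.+1)) @ +oo -->
   \sum_(i < m.+1) ((-1) ^+ i * 'C(m, i)%:R) * (A / i.+1%:R).
  apply: cvg_big => [|i _]; first exact: add_continuous.
  by apply: cvgM; [exact: cvg_cst|exact: mom].
apply: cvg_trans; apply: near_eq_cvg; near=> x.
have x1 : 1 < x by near: x; apply: nbhs_pinfty_gt; exact: num_real.
have x0 : 0 < x by exact: lt_trans x1.
have lx : ln x != 0 by rewrite gt_eqF// ln_gt0.
rewrite invfM mulrA [X in _ = X / _]mulrC [in RHS]mulr_sumr.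
under [in RHS]eq_bigr => k _.
  rewrite mulrA mulrA mulVf ?gt_eqF// mul1r ln_div ?posrE// exprBn mulr_sumr.
  over.
rewrite exchange_big/= mulr_suml; apply: eq_bigr => i _.
rewrite [in LHS]mulrA [in LHS]mulr_sumr !mulr_suml; apply: eq_bigr => k _.
rewrite -mulr_natr.
have im : (i <= m)%N by rewrite -ltnS.
have mk := lt0r_neq0 (mu0 k).
have -> : ln x ^+ m.+1 = ln x ^+ (m - i) * ln x ^+ i.+1.
  by rewrite -exprD addnS subnK.
have L1 : ln x ^+ (m - i) != 0 by rewrite expf_neq0.
have L2 : ln x ^+ i.+1 != 0 by rewrite expf_neq0.
move: L1 L2; set a := _ ^+ (m - i); set b := ln x ^+ i.+1 => L1 L2.
by field; rewrite L1 L2 mk.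
Unshelve. all: by end_near. Qed.

(** The comparison function [y * ln y ^+ m], cut off below [1], where
    [ln y] is negative. *)
Definition xlogX (R : realType) (m : nat) (y : R) : R :=
  if 1 <= y then y * ln y ^+ m else 0.

(** [F] has the features of a counting function of products that is equivalent
    to [B * x * ln x ^+ m] at infinity: it is nondecreasing and vanishes
    below some positive number. The constant [B] may be zero. *)
Definition log_asymp (R : realType) (F : R -> R) (m : nat) (B : R) : Prop :=
  [/\ {homo F : x y / x <= y}, exists2 c : R, 0 < c & forall x, x < c -> F x = 0 &
      (fun x => F x / (x * ln x ^+ m)) @ +oo --> B].

Lemma xlogX_ge0 (R : realType) (m : nat) (y : R) : 0 <= xlogX m y.
Proof.
rewrite /xlogX; case: ifPn => // y1.
by rewrite mulr_ge0 ?exprn_ge0 ?ln_ge0// (le_trans ler01).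
Qed.

Lemma xlogX_le (R : realType) (m : nat) (y z : R) :
  1 <= z -> y <= z -> xlogX m y <= z * ln z ^+ m.
Proof.
move=> z1 yz; have z0 : 0 < z by exact: lt_le_trans z1.
rewrite /xlogX; case: ifPn => y1; last first.
  by rewrite mulr_ge0 ?exprn_ge0 ?ln_ge0// ltW.
have y0 : 0 < y by exact: lt_le_trans y1.
by rewrite ler_pM ?exprn_ge0 ?ln_ge0// ?(ltW y0)// lerXn2r ?nnegrE ?ln_ge0// ler_ln.
Qed.

Lemma log_asymp_ge0 (R : realType) (F : R -> R) (m : nat) (B : R) :
  log_asymp F m B -> forall x, 0 <= F x.
Proof.
move=> [Fh [c c0 Fc] _] x.
have [xc|cx] := ltP x c; first by rewrite Fc.
rewrite -(Fc (c / 2)); last by rewrite ltr_pdivrMr// ltr_pMr// ltr1n.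
by apply: Fh; apply: le_trans cx; rewrite ler_pdivrMr// ler_peMr ?ler1n// ltW.
Qed.

(** [F] differs from [B * xlogX m] by an arbitrarily small multiple of [xlogX m]
    and a bounded function supported on [c <= y]. *)
Lemma log_asymp_error (R : realType) (F : R -> R) (m : nat) (B : R) :
  log_asymp F m B -> exists2 c : R, 0 < c <= 1 &
  (forall x, x < c -> F x = 0) /\
  forall e : R, 0 < e -> exists2 C : R, 0 <= C &
    forall y : R, `|F y - B * xlogX m y| <= e * xlogX m y + C * (c <= y)%R%:R.
Proof.
move=> FB; have F0 := log_asymp_ge0 FB; case: FB => Fh [c c0 Fc] FB.
exists (Num.min c 1); first by rewrite lt_min c0 ltr01 ge_min lexx orbT.
have Fmin x : x < Num.min c 1 -> F x = 0 by rewrite lt_min => /andP[/Fc].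
split=> // e e0.
have [Y [Y1 HY]] : exists Y, 1 < Y /\
    forall y, Y <= y -> `|B - F y / (y * ln y ^+ m)| <= e.
  have /cvgrPdist_le/(_ _ e0)[Y [_ HY]] := FB.
  exists (Num.max 2 (Y + 1)); split; first by rewrite lt_max ltr1n.
  move=> y; rewrite ge_max => /andP[_ Yy]; apply: HY.
  by apply: lt_le_trans Yy; rewrite ltrDl.
have Y0 : 0 < Y by exact: lt_trans Y1.
exists (F Y + `|B| * (Y * ln Y ^+ m)).
  by rewrite addr_ge0// mulr_ge0// mulr_ge0 ?exprn_ge0 ?ln_ge0// ltW.
move=> y; have [Yy|yY] := leP Y y.
  have y1 : 1 < y by exact: lt_le_trans Yy.
  have ly : 0 < y * ln y ^+ m.
    by rewrite mulr_gt0 ?exprn_gt0 ?ln_gt0// (lt_trans _ y1).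
  rewrite /xlogX (ltW y1); apply: ler_wpDr.
    by rewrite mulr_ge0// addr_ge0// mulr_ge0// mulr_ge0 ?exprn_ge0 ?ln_ge0// ltW.
  rewrite -ler_pdivrMr//; apply: le_trans (HY _ Yy).
  rewrite -[X in _ / X](gtr0_norm ly) -normfV -normrM distrC mulrBl mulfK//.
  exact: lt0r_neq0.
apply: ler_wpDl; first by rewrite mulr_ge0 ?xlogX_ge0// ltW.
have [cy|yc] := leP (Num.min c 1) y; last first.
  rewrite Fmin// /xlogX ifF ?mulr0 ?subr0 ?normr0//.
  by apply/negbTE; rewrite -ltNge; move: yc; rewrite lt_min => /andP[].
rewrite mulr1; apply: le_trans (ler_normB _ _) _; rewrite lerD//.
  by rewrite ger0_norm//; apply: Fh; exact: ltW.
by rewrite normrM ler_wpM2l// ger0_norm ?xlogX_ge0// xlogX_le// ltW.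
Qed.

Section AddSequence.
Variables (R : realType) (F G : R -> R) (mu : nat -> R) (m : nat) (B : R).
Hypothesis FB : log_asymp F m B.
Hypothesis mu0 : forall k, 0 < mu k.
(* The terms of the sum vanish for k large, so that it is a finite sum. *)
Hypothesis GF : forall x, \forall N \near \oo,
  G x = \sum_(0 <= k < N) F (x / mu k).

Lemma cvg_add_regular (n : R -> nat) (A : R) :
  counted_by mu n -> 0 < A -> (fun x => (n x)%:R / x) @ +oo --> A ->
  (fun x => G x / (x * ln x ^+ m.+1)) @ +oo --> A * B / m.+1%:R.
Proof.
move=> mun A0 nA.
have [c /andP[c0 c1] [Fc err]] := log_asymp_error FB.
pose S x := \sum_(0 <= k < n x) (x / mu k) * ln (x / mu k) ^+ m.
pose D (x : R) := x * ln x ^+ m.+1.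
have SD : (fun x => S x / D x) @ +oo --> A / m.+1%:R by exact: cvg_log_sum.
have SE x N : 0 < x -> (n x <= N)%N -> \sum_(0 <= k < N) xlogX m (x / mu k) = S x.
  move=> x0 nN; rewrite /S -(sum_counted_by mun _ nN); apply: eq_bigr => k _.
  by rewrite /xlogX ler_pdivlMr// mul1r.
have nE x N : (n (x / c) <= N)%N ->
    \sum_(0 <= k < N) (c <= x / mu k)%R%:R = (n (x / c))%:R :> R.
  move=> nN; rewrite -(sum1_counted_by mun nN); apply: eq_bigr => k _.
  by rewrite ler_pdivlMr// mulrC -ler_pdivlMr.
have GS e : 0 < e -> exists2 C, 0 <= C & forall x, 0 < x ->
    `|G x - B * S x| <= e * S x + C * (n (x / c))%:R.
  move=> e0; have [C C0 HC] := err _ e0; exists C => // x x0.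
  near \oo => N.
  have n1 : (n x <= N)%N by near: N; exists (n x).
  have n2 : (n (x / c) <= N)%N by near: N; exists (n (x / c)).
  have -> : G x = \sum_(0 <= k < N) F (x / mu k) by near: N; exact: GF.
  rewrite -(SE _ _ x0 n1) -(nE _ _ n2) !mulr_sumr -sumrB -big_split/=.
  by apply: le_trans (ler_norm_sum _ _ _) _; apply: ler_sum.
have -> : A * B / m.+1%:R = B * (A / m.+1%:R) + 0.
  by rewrite addr0 [A * B]mulrC mulrA.
have -> : (fun x => G x / (x * ln x ^+ m.+1)) =
    (fun x => B * (S x / D x) + (G x - B * S x) / D x).
  by apply/funext => x; rewrite mulrA -mulrDl addrCA subrr addr0.
apply: cvgD; first by apply: cvgM => //; exact: cvg_cst.
have ncD : (fun x => (n (x / c))%:R / D x) @ +oo --> (0 : R).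
  have xcy : (fun x : R => x / c) @ +oo --> +oo.
    by apply: gt0_cvgMly; rewrite ?invr_gt0//; exact: cvg_id.
  have lny : (fun x : R => ln x ^+ m.+1) @ +oo --> +oo.
    apply/cvgryPge => M; near=> x.
    have l1 : 1 <= ln x by near: x; exact: (cvgry_ge (@cvg_ln_pinfty R)).
    apply: le_trans (_ : ln x <= _).
      by near: x; exact: (cvgry_ge (@cvg_ln_pinfty R)).
    by rewrite -[leLHS]expr1 ler_weXn2l.
  pose proof (cvgM (cvgM (cvg_comp _ _ xcy nA) (cvg_cst c^-1)) (cvgyV lny))
    as h.
  move: h.
  rewrite mulr0; apply: cvg_trans; apply: near_eq_cvg; near=> x.
  have x0 : 0 < x by near: x; apply: nbhs_pinfty_gt; exact: num_real.
  transitivity ((n (x / c))%:R / (x / c) / c / ln x ^+ m.+1); first by [].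
  rewrite /D [in RHS]invfM mulrA; congr (_ / _).
  by field; rewrite !gt_eqF.
apply/cvgrPdist_le => e e0.
(* An eventual bound of [S x / D x]. *)
pose q := A / m.+1%:R + 1.
have q0 : 0 < q by rewrite addr_gt0// divr_gt0.
have eq0 : 0 < e / 2 / q by rewrite !divr_gt0.
have [C C0 HC] := GS _ eq0.
have C10 : 0 < C + 1 by rewrite ltr_wpDl.
have eC0 : 0 < e / 2 / (C + 1) by rewrite !divr_gt0.
near=> x.
have x1 : 1 < x by near: x; apply: nbhs_pinfty_gt; exact: num_real.
have x0 : 0 < x by exact: lt_trans x1.
have D0 : 0 < D x by rewrite mulr_gt0// exprn_gt0// ln_gt0.
rewrite sub0r normrN normrM normfV (gtr0_norm D0).
have h1 : S x / D x <= q.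
  by near: x; apply: (cvgr_le _ SD); rewrite /q ltrDl.
have h2 : (n (x / c))%:R / D x <= e / 2 / (C + 1).
  by near: x; apply: (cvgr_le _ ncD).
apply: le_trans (_ : (e / 2 / q * S x + C * (n (x / c))%:R) / D x <= _).
  by rewrite ler_pM2r ?invr_gt0// HC.
rewrite mulrDl [leRHS]splitr lerD//.
  by rewrite -mulrA -[leRHS](divfK (lt0r_neq0 q0)) ler_pM2l.
rewrite -mulrA -[leRHS](divfK (lt0r_neq0 C10)) mulrC ler_pM//.
  by rewrite divr_ge0// ltW.
by rewrite lerDl.
Unshelve. all: by end_near. Qed.

(** * Adding a sequence with summable inverses *)

Lemma cvg_add_summable (m0 s : R) :
  0 < m0 -> (forall k, m0 <= mu k) ->
  series (fun k => (mu k)^-1) @ \oo --> s ->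
  (fun x => G x / (x * ln x ^+ m)) @ +oo --> B * s.
Proof.
move=> m00 m0mu smu.
have [c /andP[c0 c1] [Fc err]] := log_asymp_error FB.
have F0 := log_asymp_ge0 FB.
have [C C0 HC] := err _ ltr01.
(* The domination constant: the factor [2 ^+ m] comes from the eventual bound
   [ln (x / mu k) <= ln (x / m0) <= 2 * ln x], and [C / c] from
   [(c <= y) <= y / c]. *)
pose K := (`|B| + 1) * 2 ^+ m + C / c.
have BK : `|B| <= K.
  rewrite ler_wpDr ?divr_ge0// ?(ltW c0)//.
  apply: le_trans (_ : `|B| + 1 <= _); first by rewrite lerDl.
  by rewrite ler_peMr ?addr_ge0// exprn_ege1// ler1n.
have yk k : (fun x => x / mu k) @ +oo --> +oo.
  by apply: gt0_cvgMly; rewrite ?invr_gt0//; exact: cvg_id.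
apply: (@tannery _ _ _ _ (fun k x => F (x / mu k) / (x * ln x ^+ m)) _
    (fun k => B * (mu k)^-1) (fun k => K * (mu k)^-1)).
- move=> k.
  have [_ _ FBc] := FB.
  have lnr := cvg_ln_dilation (mu0 k).
  pose proof (cvgM (cvgM (cvg_comp _ _ (yk k) FBc) (cvg_cst (mu k)^-1))
    (cvgXn m lnr)) as h.
  move: h.
  rewrite expr1n mulr1; apply: cvg_trans; apply: near_eq_cvg; near=> x.
  have x1 : 1 < x by near: x; apply: nbhs_pinfty_gt; exact: num_real.
  have x0 : 0 < x by exact: lt_trans x1.
  have y1 : 1 < x / mu k.
    by near: x; exact: (cvgry_gt (yk k)).
  have l1 : ln (x / mu k) ^+ m != 0 by rewrite expf_neq0// gt_eqF// ln_gt0.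
  have l2 : ln x ^+ m != 0 by rewrite expf_neq0// gt_eqF// ln_gt0.
  rewrite /= expr_div_n; move: l1 l2; set a := ln (x / _) ^+ m; set b := ln x ^+ m.
  move=> l1 l2; field.
  by rewrite l1 l2 !gt_eqF.
- have lnr := cvg_ln_dilation m00.
  near=> x => k.
  have x0 : 0 < x by near: x; apply: nbhs_pinfty_gt; exact: num_real.
  have l1 : 1 <= ln x by near: x; exact: (cvgry_ge (@cvg_ln_pinfty R)).
  have l0 : 0 < ln x by exact: lt_le_trans l1.
  have l2 : ln (x / m0) <= 2 * ln x.
    by rewrite -ler_pdivrMr//; near: x; apply: (cvgr_le _ lnr); rewrite ltr1n.
  have lm1 : 1 <= ln x ^+ m by rewrite exprn_ege1.
  have lm0 : 0 < ln x ^+ m by rewrite exprn_gt0.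
  have yk0 : 0 < x / mu k by rewrite divr_gt0.
  rewrite ger0_norm; last by rewrite divr_ge0// mulr_ge0// ltW.
  rewrite ler_pdivrMr ?mulr_gt0//.
  have -> : K / mu k * (x * ln x ^+ m) =
      (`|B| + 1) * (x / mu k * (2 * ln x) ^+ m) +
      C * (x / mu k / c * ln x ^+ m).
    by rewrite exprMn /K; field; rewrite !gt_eqF.
  have := HC (x / mu k); rewrite mul1r => {}HC.
  have Hle : F (x / mu k) <=
      (`|B| + 1) * xlogX m (x / mu k) + C * (c <= x / mu k)%R%:R.
    have h1 := le_trans (ler_norm _) HC.
    rewrite mulrDl mul1r -addrA -lerBlDl; apply: le_trans h1.
    by rewrite lerD2l lerN2 ler_wpM2r ?xlogX_ge0// ler_norm.
  apply: le_trans Hle _; rewrite lerD//.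
    rewrite ler_wpM2l ?addr_ge0// /xlogX; case: ifPn => y1; last first.
      by rewrite mulr_ge0 ?(ltW yk0)// exprn_ge0// mulr_ge0// ltW.
    rewrite ler_pM2l// lerXn2r ?nnegrE ?ln_ge0 ?mulr_ge0// ?(ltW l0)//.
    apply: le_trans l2; rewrite ler_ln ?posrE ?divr_gt0//.
    by rewrite ler_pM2l// lef_pV2 ?posrE.
  rewrite ler_wpM2l//; case: (leP c (x / mu k)) => cy; last first.
    by rewrite !mulr_ge0// ?invr_ge0 ltW.
  rewrite -[leLHS]mulr1 ler_pM//; by rewrite ler_pdivlMr// mul1r.
- have : series (fun k => K * (mu k)^-1) @ \oo --> K * s.
    rewrite (_ : series _ = (fun n => K * series (fun k => (mu k)^-1) n)); last first.
      by apply/funext => n; rewrite /series/= mulr_sumr.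
    by apply: cvgM => //; exact: cvg_cst.
  by move/cvgP.
- by move=> k; rewrite normrM ler_pM// ger0_norm// invr_ge0 ltW.
- rewrite (_ : series _ = (fun n => B * series (fun k => (mu k)^-1) n)); last first.
    by apply/funext => n; rewrite /series/= mulr_sumr.
  by apply: cvgM => //; exact: cvg_cst.
- near=> x; near=> N.
  rewrite -mulr_suml; congr (_ / _); near: N; exact: GF.
Unshelve. all: by end_near. Qed.

End AddSequence.

(** * Summability of inverse powers *)

(** Comparison with a telescoping series: for [d = a - 1],
    [k.+2 `^ (- a)] is at most [(k.+1 `^ (- d) - k.+2 `^ (- d)) / d]. *)
Lemma cvg_riemannR (R : realType) (a : R) : 1 < a -> cvgn (series (riemannR a)).
Proof.
move=> a1; pose d := a - 1.
have d0 : 0 < d by rewrite subr_gt0.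
pose P (k : nat) : R := expR (- d * ln k.+1%:R).
have rP k : riemannR a k = P k / k.+1%:R.
  rewrite /riemannR /P /powR pnatr_eq0/= -expRN.
  rewrite (_ : a = d + 1); last by rewrite subrK.
  by rewrite mulrDl mul1r opprD expRD mulNr -lnV ?posrE// lnK ?posrE ?invr_gt0.
have step k : riemannR a k.+1 <= d^-1 * (P k - P k.+1).
  rewrite ler_pdivlMl// rP lerBrDr.
  have -> : P k = P k.+1 * expR (d * (ln k.+2%:R - ln k.+1%:R)).
    by rewrite -expRD; congr expR; ring.
  rewrite mulrCA -[X in _ + X]mulr1 -mulrDr ler_pM2l ?expR_gt0// addrC.
  apply: le_trans (expR_ge1Dx _); rewrite lerD2l ler_pM2l//.
  by have /andP[] := @ln_succ_bounds R k.
have bnd n : series (riemannR a) n.+1 <= 1 + d^-1 * (1 - P n).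
  elim: n => [|n IH]; rewrite /series/= big_nat_recr//=.
    by rewrite big_geq// add0r /riemannR powR1 invr1 /P ln1 mulr0 expR0 subrr mulr0 addr0.
  apply: le_trans (lerD IH (step n)) _.
  by rewrite -addrA lerD2l -mulrDr ler_pM2l ?invr_gt0// addrA subrK.
have nd : nondecreasing_seq (series (riemannR a)).
  apply/nondecreasing_seqP => k; rewrite /series/= big_nat_recr//=.
  by rewrite lerDl invr_ge0 powR_ge0.
apply: nondecreasing_is_cvgn => //.
exists (1 + d^-1) => _ [n _ <-].
apply: le_trans (nd _ _ (leqnSn n)) _; apply: le_trans (bnd n) _.
by rewrite lerD2l ler_piMr ?invr_ge0 ?(ltW d0)// gerBl expR_ge0.
Qed.

(** The terms satisfy [k.+1 <= D * lam k `^ tau], since [k.+1] is at most the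
    number of terms that do not exceed [lam k]. *)
Lemma cvg_series_powR_counted (R : realType) (lam : nat -> R) (n : R -> nat)
    (tau alpha C : R) :
  (forall k, 0 < lam k) -> counted_by lam n -> 0 <= tau -> tau < alpha ->
  (\forall x \near +oo, (n x)%:R <= C * x `^ tau) ->
  cvgn (series (fun k => (lam k `^ alpha)^-1)).
Proof.
move=> lam0 lamn t0 ta nC.
have lamt0 k : 0 < lam k `^ tau by rewrite powR_gt0.
have [K _ HK] : \forall k \near \oo, k.+1%:R <= C * lam k `^ tau.
  near=> k; apply: le_trans (_ : (n (lam k))%:R <= _).
    by rewrite ler_nat lamn.
  by near: k; exact: (counted_by_cvgry lamn nC).
pose S := \sum_(j < K) j.+1%:R / lam j `^ tau.
have S0 : 0 <= S by apply: sumr_ge0 => j _; rewrite divr_ge0 ?powR_ge0.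
(* The summand [S] takes care of the finitely many [k < K]. *)
pose D := 1 + `|C| + S.
have D0 : 0 < D by rewrite /D -addrA ltr_wpDr// addr_ge0.
have HD k : k.+1%:R <= D * lam k `^ tau.
  rewrite -ler_pdivrMr//; have [kK|Kk] := ltnP k K.
    apply: le_trans (_ : S <= _); last by rewrite /D lerDr addr_ge0.
    rewrite /S (bigD1 (Ordinal kK))//= lerDl.
    by apply: sumr_ge0 => j _; rewrite divr_ge0 ?powR_ge0.
  apply: le_trans (_ : C <= _); first by rewrite ler_pdivrMr// HK.
  by rewrite /D addrAC ler_wpDl ?ler_norm// addr_ge0.
(* For [tau = 0] the sequence would be finite. *)
have [t00|tpos] := eqVneq tau 0.
  near \oo => k; have := HD k; rewrite t00 powRr0 mulr1 leNgt => /negP[].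
  by near: k; exact: (cvgry_gt (@cvg_natS R)).
have {}t0 : 0 < tau by rewrite lt0r tpos.
pose b := alpha / tau.
have b1 : 1 < b by rewrite /b ltr_pdivlMr// mul1r.
have b0 : 0 < b by exact: lt_trans b1.
apply: (@series_le_cvg _ _ (fun k => D `^ b * riemannR b k)).
- by move=> k; rewrite invr_ge0 powR_ge0.
- by move=> k; rewrite mulr_ge0 ?powR_ge0// invr_ge0 powR_ge0.
- move=> k.
  have -> : lam k `^ alpha = (lam k `^ tau) `^ b.
    by rewrite -powRrM /b mulrCA divff// mulr1.
  rewrite /riemannR -[leRHS]invrK invfM invrK lef_pV2 ?posrE ?powR_gt0//; last first.
    by rewrite mulr_gt0 ?invr_gt0 ?powR_gt0.
  rewrite ler_pdivrMl ?powR_gt0// -powRM ?(ltW D0) ?(ltW (lamt0 _))//.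
  apply: ge0_ler_powR (HD k); first exact: ltW.
  - by rewrite nnegrE.
  - by rewrite nnegrE mulr_ge0// ltW.
- rewrite (_ : series _ = (fun n => D `^ b * series (riemannR b) n)); last first.
    by apply/funext => N; rewrite /series/= mulr_sumr.
  apply: is_cvgM; [exact: is_cvg_cst|exact: cvg_riemannR].
Unshelve. all: by end_near. Qed.

(** * Counting products *)

Section ProductCount.
Variables (R : realType) (I : finType) (mu : I -> nat -> R).
Hypothesis mu0 : forall j k, 0 < mu j k.
Hypothesis mu_nd : forall j, nondecreasing_seq (mu j).
Variable n : I -> R -> nat.
Hypothesis mun : forall j, counted_by (mu j) (n j).

(** The choices of one term in each of the sequences indexed in [s] whose
    product is at most [x]. A choice is a function on all of [I]; the condition
    that it vanishes outside [s] makes it determined by its values on [s]. *)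
Definition prod_below (s : seq I) (x : R) : set {ffun I -> nat} :=
  [set k | (forall j, j \notin s -> k j = 0%N) /\
           \prod_(j <- s) mu j (k j) <= x].

(** The cardinality of [prod_below s x] as a real number. It is meaningful when
    that set is finite, and is [0] otherwise. *)
Definition prod_count (s : seq I) (x : R) : R :=
  (#|` fset_set (prod_below s x) |)%:R.

(** [k] with its value at [j] changed to [i]. *)
Definition ffun_upd (j : I) (i : nat) (k : {ffun I -> nat}) :
    {ffun I -> nat} :=
  [ffun a => if a == j then i else k a].

(** For [j] outside [s], the elements of [prod_below (j :: s) x] whose value at
    [j] is [i]. *)
Definition prod_slice (s : seq I) (j : I) (x : R) (i : nat) :
    set {ffun I -> nat} :=
  ffun_upd j i @` prod_below s (x / mu j i).

(* The least product of one term from each of the sequences indexed in s. *)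
Let least (s : seq I) : R := \prod_(j <- s) mu j 0%N.

Lemma prod_below_lt (s : seq I) (x : R) :
  x < least s -> prod_below s x = set0.
Proof.
move=> xs; apply/seteqP; split => // k [_]; rewrite leNgt => /negP; apply.
apply: lt_le_trans xs _; apply: ler_prod => j _.
by rewrite ltW//= mu_nd.
Qed.

Lemma prod_below_cons (s : seq I) (j : I) (x : R) (N : nat) :
  j \notin s -> (n j (x / least s) <= N)%N ->
  prod_below (j :: s) x =
  \big[setU/set0]_(i < N) prod_slice s j x i.
Proof.
move=> js nN; rewrite -bigcup_mkord; apply/seteqP; split => k.
  move=> [k0]; rewrite big_cons => kx.
  (* [k'] lies in [prod_below s (x / mu j (k j))], so this set is nonempty and
     [least s <= x / mu j (k j)], which bounds [k j]. *)
  pose k' := ffun_upd j 0 k.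
  have kE : k = ffun_upd j (k j) k'.
    by apply/ffunP => a; rewrite !ffunE; case: eqVneq => [->|].
  have kb : prod_below s (x / mu j (k j)) k'.
    split.
      move=> a as_; rewrite ffunE; case: eqVneq => // aj.
      by apply: k0; rewrite inE negb_or aj.
    rewrite ler_pdivlMr// mulrC; apply: le_trans kx.
    rewrite ler_pM2l//; rewrite [leLHS]big_seq [leRHS]big_seq.
    rewrite le_eqVlt; apply/orP; left; apply/eqP; apply: eq_bigr => a as_.
    by rewrite ffunE; case: eqVneq as_ js => // -> ->.
  exists (k j) => /=; last by exists k'.
  apply: leq_trans nN; rewrite mun ler_pdivlMr ?prodr_gt0// mulrC -ler_pdivlMr//.
  rewrite leNgt; apply/negP => /prod_below_lt E.
  by rewrite E in kb.
move=> [i /= iN [k' [k'0 k'x] <-]]; split.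
  move=> a; rewrite inE negb_or => /andP[aj as_].
  by rewrite ffunE (negbTE aj) k'0.
rewrite big_cons ffunE eqxx mulrC -ler_pdivlMr//; apply: le_trans k'x.
rewrite [leLHS]big_seq [leRHS]big_seq.
rewrite le_eqVlt; apply/orP; left; apply/eqP; apply: eq_bigr => a as_.
by rewrite ffunE; case: eqVneq as_ js => // -> ->.
Qed.

(** The recursion obtained by sorting the products by their factor from the
    sequence [mu j]. *)
Lemma prod_count_cons (s : seq I) (j : I) (x : R) (N : nat) :
  j \notin s -> (forall y, finite_set (prod_below s y)) ->
  (n j (x / least s) <= N)%N ->
  finite_set (prod_below (j :: s) x) /\
  prod_count (j :: s) x = \sum_(0 <= i < N) prod_count s (x / mu j i).
Proof.
move=> js fs nN.
have fF i : finite_set (prod_slice s j x i).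
  exact: finite_image.
split.
  by rewrite (prod_below_cons js nN) -bigcup_mkord; exact: bigcup_finite.
rewrite /prod_count (prod_below_cons js nN) -trivIset_sum_card//; last first.
  move=> i i' _ _ [k [[k1 _ <-] [k2 _]]] /ffunP/(_ j).
  by rewrite !ffunE eqxx => ->.
rewrite natr_sum big_mkord; apply: eq_bigr => i _; congr (_%:R).
rewrite /prod_slice fset_set_image// card_in_imfset//= => k1 k2 /=.
rewrite !in_fset_set// => /set_mem[k10 _] /set_mem[k20 _] /ffunP E.
apply/ffunP => a.
have := E a; rewrite !ffunE; case: eqVneq => // -> _.
by rewrite k10// k20.
Qed.

Lemma prod_count_nil (x : R) :
  finite_set (prod_below [::] x) /\ prod_count [::] x = (1 <= x)%R%:R.
Proof.
rewrite /prod_count; have [x1|x1] := leP 1 x; last first.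
  by rewrite prod_below_lt ?fset_set0// /least big_nil.
have -> : prod_below [::] x = [set [ffun=> 0%N]].
  apply/seteqP; split => k.
    by move=> [k0 _]; apply/ffunP => j; rewrite k0// ffunE.
  by move=> ->; split => [j _|]; rewrite ?ffunE// big_nil.
by rewrite fset_set1 cardfs1.
Qed.

Lemma prod_count_homo (s : seq I) : (forall y, finite_set (prod_below s y)) ->
  {homo prod_count s : x y / x <= y}.
Proof.
move=> fs x y xy; rewrite ler_nat; apply: fsubset_leq_card.
rewrite -fset_set_sub// => k [k0 kx]; split => //; exact: le_trans xy.
Qed.

Lemma prod_count_lt (s : seq I) (x : R) : x < least s -> prod_count s x = 0.
Proof. by move=> /prod_below_lt E; rewrite /prod_count E fset_set0. Qed.

(** The theorem for [alpha = 1] and real-valued counting functions. For [j] in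
    [P] the counting function of [mu j] is equivalent to [c j * x]; for the other
    [j] the inverses of the terms of [mu j] have sum [c j]. One sequence [j0] of the first kind is
    set apart, so that the exponent of the logarithm is the number of those that
    remain. *)
Lemma prod_count_log_asymp (P : pred I) (c : I -> R) (j0 : I) :
  P j0 ->
  (forall j, P j -> 0 < c j /\ (fun x => (n j x)%:R / x) @ +oo --> c j) ->
  (forall j, ~~ P j -> series (fun k => (mu j k)^-1) @ \oo --> c j) ->
  forall s, uniq (rcons s j0) ->
  (forall x, finite_set (prod_below (rcons s j0) x)) /\
  log_asymp (prod_count (rcons s j0)) (count P s)
    ((\prod_(j <- rcons s j0) c j) / (count P s)`!%:R).
Proof.
move=> Pj0 cP cNP; elim => [|j s IH].
  move=> _.
  have H x N := @prod_count_cons [::] j0 x N isT (fun y => (prod_count_nil y).1).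
  have fin x : finite_set (prod_below [:: j0] x).
    by have [] := H x _ (leqnn _).
  have E x : prod_count [:: j0] x = (n j0 x)%:R.
    have [_ ->] := H x (maxn (n j0 (x / least [::])) (n j0 x)) (leq_maxl _ _).
    rewrite -(sum1_counted_by (mun j0) (leq_maxr (n j0 (x / least [::])) _)).
    apply: eq_bigr => k _.
    by rewrite (prod_count_nil _).2 ler_pdivlMr// mul1r.
  split => //; split.
  - exact: prod_count_homo.
  - exists (least [:: j0]); first by rewrite prodr_gt0.
    by move=> x; exact: prod_count_lt.
  - rewrite /= big_seq1 fact0 divr1; under eq_fun do rewrite E expr0 mulr1.
    by have [] := cP _ Pj0.
rewrite rcons_cons => /= /andP[js us]; have [fs FB] := IH us.
have H x N := @prod_count_cons _ j x N js fs.
have fin x : finite_set (prod_below (j :: rcons s j0) x).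
  by have [] := H x _ (leqnn _).
have rec x : \forall N \near \oo, prod_count (j :: rcons s j0) x =
    \sum_(0 <= k < N) prod_count (rcons s j0) (x / mu j k).
  by exists (n j (x / least (rcons s j0))) => // N /= nN; have [] := H x N nN.
split => //; split.
- exact: prod_count_homo.
- exists (least (j :: rcons s j0)); first by rewrite prodr_gt0.
  by move=> x; exact: prod_count_lt.
have [Pj|NPj] := boolP (P j).
  have [c0 cj] := cP _ Pj.
  rewrite add1n big_cons.
  have := cvg_add_regular FB (mu0 j) rec (mun j) c0 cj.
  by rewrite factS natrM invfM [_^-1 / _]mulrC !mulrA.
rewrite add0n big_cons.
have := cvg_add_summable FB (mu0 j) rec (mu0 j 0%N)
  (fun k => mu_nd j (leq0n k)) (cNP _ NPj).
by rewrite mulrC mulrA.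
Qed.

End ProductCount.

(** * From extended real-valued counting functions to integers *)

Lemma counting_fun_fin_unbounded (R : realType) (lam : nat -> R) :
  (\forall x \near +oo, (counting_fun lam x < +oo)%E) ->
  forall x, exists k, x < lam k.
Proof.
move=> lamfin x; apply: contrapT => nex.
near (+oo : set_system R) => y.
have : (counting_fun lam y < +oo)%E by near: y.
rewrite /counting_fun (_ : [set _ | _] = setT).
  by rewrite /counting asboolF ?ltxx//; exact: infinite_nat.
apply/seteqP; split => // k _ /=; apply: le_trans (_ : x <= _).
  by rewrite leNgt; apply/negP => xk; apply: nex; exists k.
by near: y; apply: nbhs_pinfty_ge; exact: num_real.
Unshelve. all: by end_near. Qed.

Lemma exists_counted_by (R : realType) (lam : nat -> R) :
  nondecreasing_seq lam -> (forall x, exists k, x < lam k) ->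
  exists n, counted_by lam n /\ forall x, counting_fun lam x = (n x)%:R%:E.
Proof.
move=> nd unb; pose n x := ex_minn (unb x).
have nP : counted_by lam n.
  move=> x k; rewrite /n; case: ex_minnP => m xm mmin.
  have [km|mk] := ltnP k m.
    by apply/esym; rewrite leNgt; apply/negP => /mmin; rewrite leqNgt km.
  by apply/esym/negbTE; rewrite -ltNge; apply: lt_le_trans xm _; exact: nd.
exists n; split => // x; rewrite /counting_fun.
have -> : [set k | lam k <= x] = `I_(n x).
  by apply/seteqP; split => k /=; rewrite nP.
rewrite /counting asboolT//; congr (_%:R%:E).
by apply/card_eq_fsetP; rewrite fset_setK.
Qed.

(** Equivalence to a real-valued function makes a nonnegative function finite
    and its equivalent positive near infinity. When [g x = 0] the quotient is
    [0] or [+oo], as division by zero gives [f x * +oo]. *)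
Lemma asymp_equiv_real (R : realType) (f : R -> \bar R) (g : R -> R) :
  (forall x, (0 <= f x)%E) -> asymp_equiv f (fun x => (g x)%:E) ->
  (\forall x \near +oo, f x \is a fin_num /\ 0 < g x) /\
  (fun x => fine (f x) / g x) @ +oo --> (1 : R).
Proof.
move=> f0 /fine_cvgP[fgfin fg1].
have fin : \forall x \near +oo, f x \is a fin_num /\ 0 < g x.
  near=> x.
  have h1 : (f x / (g x)%:E)%E \is a fin_num by near: x.
  have h2 : 0 < fine (f x / (g x)%:E)%E by near: x; exact: (cvgr_gt _ fg1).
  move: (f0 x) h1 h2; case: (f x) => [r| |] //=; rewrite inver.
    case: eqVneq => [_|gx0].
      rewrite lee_fin le_eqVlt => /predU1P[<-|r0]; first by rewrite mul0e ltxx.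
      by rewrite gt0_muley// lte_fin.
    rewrite lee_fin le_eqVlt => /predU1P[<-|r0] _; first by rewrite /= mul0r ltxx.
    by rewrite /= pmulr_rgt0// invr_gt0.
  case: eqVneq => [_|gx0] _; first by rewrite mulyy.
  move: gx0; rewrite neq_lt => /orP[] gx.
    by rewrite lt0_mulye// lte_fin invr_lt0.
  by rewrite gt0_mulye// lte_fin invr_gt0.
split => //; move: fg1; apply: cvg_trans; apply: near_eq_cvg; near=> x.
have [/fineK fx gx] : f x \is a fin_num /\ 0 < g x by near: x.
by rewrite /= -fx inver gt_eqF.
Unshelve. all: by end_near. Qed.

Lemma counting_fun_ge0 (R : realType) (lam : nat -> R) (x : R) :
  (0 <= counting_fun lam x)%E.
Proof. exact: measure_ge0. Qed.

Lemma ler_powR_mono (R : realType) (a x y : R) : 0 < a -> 0 <= x -> 0 <= y ->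
  (x `^ a <= y `^ a) = (x <= y).
Proof. by move=> a0 x0 y0; apply: (le_mono_in (gt0_ltr_powR a0)). Qed.

Lemma cvg_powR_pinfty (R : realType) (a : R) : 0 < a ->
  (fun x : R => x `^ a) @ +oo --> +oo.
Proof.
move=> a0; apply/cvgryPge => M; near=> x.
apply: le_trans (_ : Num.max M 0 <= _); first by rewrite le_max lexx.
have M0 : 0 <= Num.max M 0 by rewrite le_max lexx orbT.
have -> : Num.max M 0 = (Num.max M 0 `^ a^-1) `^ a.
  by rewrite -powRrM mulVf ?gt_eqF// powRr1.
by rewrite ler_powR_mono ?powR_ge0.
Unshelve. all: by end_near. Qed.

Lemma powR_prod (R : realType) (I : Type) (s : seq I) (f : I -> R) (a : R) :
  (forall i, 0 <= f i) -> (\prod_(i <- s) f i) `^ a = \prod_(i <- s) (f i `^ a).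
Proof.
move=> f0; elim: s => [|i s IH]; first by rewrite !big_nil powR1.
by rewrite !big_cons powRM ?IH// prodr_ge0.
Qed.

Theorem proposition2p1 (R : realType) (p : nat) (lam : 'I_p -> nat -> R)
    (tau alpha : R) (nu : nat) (jq : 'I_nu -> 'I_p) (Aq : 'I_nu -> R) :
  (1 <= p)%N ->
  (forall j k, 0 < lam j k) ->
  (forall j, nondecreasing_seq (lam j)) ->
  0 <= tau -> tau < alpha ->
  (1 <= nu <= p)%N ->
  injective jq ->
  (forall q, Aq q != 0) ->
  (forall q, asymp_equiv (counting_fun (lam (jq q)))
                         (fun x => (Aq q * x `^ alpha)%:E)) ->
  (forall j, j \notin codom jq ->
     asymp_bigO (counting_fun (lam j)) (fun x => x `^ tau)) ->
  let A : \bar R :=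
    ((\prod_(q < nu) Aq q)%:E *
     \prod_(j < p | j \notin codom jq)
        \sum_(0 <= k <oo) ((lam j k `^ alpha)^-1)%:E)%E in
  asymp_equiv (prod_counting_fun lam)
    (fun x => A * (x `^ alpha * ((alpha * ln x) ^+ nu.-1 / nu.-1`!%:R))%:E)%E.
Proof.
move=> _ lam0 lam_nd tau0 ta /andP[nu0 _] jq_inj _ Areg Aneg A.
have a0 : 0 < alpha by exact: le_lt_trans ta.
pose P := [pred j | j \in codom jq].
have regular q :
    (\forall x \near +oo, counting_fun (lam (jq q)) x \is a fin_num /\
                          0 < Aq q * x `^ alpha) /\
    (fun x => fine (counting_fun (lam (jq q)) x) / (Aq q * x `^ alpha))
      @ +oo --> (1 : R).
  by apply: asymp_equiv_real (Areg q) => x; exact: counting_fun_ge0.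
have negl j : j \notin codom jq -> exists C : R,
    \forall x \near +oo, (counting_fun (lam j) x <= (C * x `^ tau)%:E)%E.
  move=> /Aneg[C HC]; exists C; near=> x.
  have : (`|counting_fun (lam j) x| <= (C * `|x `^ tau|)%:E)%E by near: x.
  by rewrite gee0_abs ?counting_fun_ge0// ger0_norm ?powR_ge0.
have [n nP] : exists n : 'I_p -> R -> nat, forall j,
    counted_by (lam j) (n j) /\ forall x, counting_fun (lam j) x = (n j x)%:R%:E.
  suff /choice[n nP] : forall j, exists m, counted_by (lam j) m /\
      forall x, counting_fun (lam j) x = (m x)%:R%:E by exists n.
  move=> j.
  apply: exists_counted_by => //; apply: counting_fun_fin_unbounded.
  have [/codomP[q ->]|/negl[C HC]] := boolP (j \in codom jq); near=> x.
    have [h _] : counting_fun (lam (jq q)) x \is a fin_num /\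
        0 < Aq q * x `^ alpha.
      by near: x; have [] := regular q.
    by rewrite ltey_eq h.
  by apply: (@le_lt_trans _ _ (C * x `^ tau)%:E); [near: x|exact: ltry].
have Aq0 q : 0 < Aq q.
  have [h _] := regular q; near (+oo : set_system R) => x.
  have x0 : 0 < x by near: x; apply: nbhs_pinfty_gt; exact: num_real.
  have [_] : counting_fun (lam (jq q)) x \is a fin_num /\
      0 < Aq q * x `^ alpha by near: x.
  by rewrite pmulr_lgt0// powR_gt0.
(* Reduction to [alpha = 1]; [n' j] counts the terms of [mu j]. *)
pose mu j k := lam j k `^ alpha.
have mu0 j k : 0 < mu j k by rewrite powR_gt0.
have mu_nd j : nondecreasing_seq (mu j).
  by move=> k l kl; rewrite ler_powR_mono ?(ltW (lam0 _ _))//; exact: lam_nd.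
pose n' j y := if 0 < y then n j (y `^ alpha^-1) else 0%N.
have powVK y : 0 < y -> (y `^ alpha^-1) `^ alpha = y.
  by move=> y0; rewrite -powRrM mulVf ?gt_eqF// powRr1// ltW.
have mun j : counted_by (mu j) (n' j).
  move=> y k; rewrite /n'; case: ltP => y0; last first.
    by apply/esym/negbTE; rewrite -ltNge; exact: le_lt_trans (mu0 j k).
  by rewrite (nP j).1 -{2}(powVK _ y0) ler_powR_mono ?powR_ge0// ltW.
have series_fin j : j \notin codom jq -> cvgn (series (fun k => (mu j k)^-1)).
  move=> /negl[C HC]; apply: (@cvg_series_powR_counted _ _ (n j) tau alpha C) => //.
    exact: (nP j).1.
  by near=> x; rewrite -lee_fin -(nP j).2; near: x.
pose c j := if [pick q | jq q == j] is Some q then Aq q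
            else limn (series (fun k => (mu j k)^-1)).
have c_jq q : c (jq q) = Aq q.
  by rewrite /c; case: pickP => [r /eqP/jq_inj->//|/(_ q)]; rewrite eqxx.
have c_neg j : j \notin codom jq -> c j = limn (series (fun k => (mu j k)^-1)).
  move=> jN; rewrite /c; case: pickP => // q /eqP qj.
  by rewrite -qj codom_f in jN.
have cP j : P j -> 0 < c j /\ (fun x => (n' j x)%:R / x) @ +oo --> c j.
  move=> /codomP[q ->]; rewrite c_jq; split => //.
  have [_ h] := regular q.
  have aV0 : 0 < alpha^-1 by rewrite invr_gt0.
  pose proof (cvgM (cvg_cst (Aq q))
    (cvg_comp _ _ (cvg_powR_pinfty aV0) h)) as hh.
  move: hh; rewrite mulr1; apply: cvg_trans; apply: near_eq_cvg; near=> x.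
  have x0 : 0 < x by near: x; apply: nbhs_pinfty_gt; exact: num_real.
  rewrite /n' x0 /= (nP _).2 /= powVK//.
  by rewrite invfM mulrCA mulVKf ?gt_eqF.
have cNP j : ~~ P j -> series (fun k => (mu j k)^-1) @ \oo --> c j.
  by move=> jN; rewrite c_neg//; exact: series_fin.
have AE : A = (\prod_j c j)%:E.
  rewrite /A [in RHS](bigID P)/= EFinM; congr (_ * _)%E.
    congr (_%:E); rewrite -big_uniq/=; last by rewrite map_inj_uniq// enum_uniq.
    by rewrite big_image/=; under [in RHS]eq_bigr do rewrite c_jq.
  rewrite -prodEFin; apply: eq_bigr => j jN.
  rewrite c_neg// -EFin_lim; last exact: series_fin.
  by congr (limn _); apply/funext => N; rewrite /= /series/= sumEFin.
have Pc0 : 0 < \prod_j c j.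
  apply: prodr_gt0 => j _; have [/cP[]//|jN] := boolP (P j).
  rewrite c_neg//; apply: lt_le_trans (_ : series (fun k => (mu j k)^-1) 1%N <= _).
    by rewrite /series/= big_nat1 invr_gt0.
  apply: nondecreasing_cvgn_le; last exact: series_fin.
  apply/nondecreasing_seqP => k; rewrite /series/= big_nat_recr//=.
  by rewrite lerDl invr_ge0 ltW.
pose j0 := jq (Ordinal nu0).
have Pj0 : P j0 by exact: codom_f.
pose s := rem j0 (enum 'I_p).
have sE : perm_eq (rcons s j0) (enum 'I_p).
  by rewrite perm_rcons perm_sym perm_to_rem// mem_enum.
have count_s : count P s = nu.-1.
  have : count P (enum 'I_p) = nu.
    rewrite -[RHS](card_ord nu) -(card_codom jq_inj) cardE.
    by rewrite [in RHS]/enum_mem size_filter enumT.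
  have h1 : count P [:: j0] = 1%N by rewrite /= codom_f.
  by rewrite -(seq.permP sE) -cats1 count_cat h1 addn1 => <-.
have [fin [_ _ FB]] := prod_count_log_asymp mu0 mu_nd mun Pj0 cP cNP
  (etrans (perm_uniq sE) (enum_uniq _)).
rewrite count_s (perm_big _ sE)/= big_enum/= in FB.
set t := rcons s j0 in fin FB.
have prodE x : 0 < x -> prod_counting_fun lam x = (prod_count mu t (x `^ alpha))%:E.
  move=> x0; rewrite /prod_counting_fun.
  have -> : [set k : {ffun 'I_p -> nat} | \prod_(j < p) lam j (k j) <= x] =
      prod_below mu t (x `^ alpha).
    have E k : (\prod_(j <- t) mu j (k j) <= x `^ alpha) =
               (\prod_(j < p) lam j (k j) <= x).
      rewrite (perm_big _ sE)/= big_enum/= -powR_prod; last by move=> j; rewrite ltW.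
      by rewrite ler_powR_mono ?(ltW x0)// prodr_ge0// => j _; rewrite ltW.
    apply/seteqP; split => k /=; rewrite /prod_below/= E; last by case.
    by split => // j; rewrite (perm_mem sE) mem_enum.
  by rewrite /counting asboolT.
rewrite /asymp_equiv AE; set B := \prod_j c j in Pc0 FB *.
set m := nu.-1 in FB *.
have m0 : m`!%:R != 0 :> R by rewrite pnatr_eq0 -lt0n fact_gt0.
have lim1 : (fun x => prod_count mu t (x `^ alpha) /
    (x `^ alpha * ln (x `^ alpha) ^+ m) * (m`!%:R / B)) @ +oo --> (1 : R).
  pose proof (cvgM (cvg_comp _ _ (cvg_powR_pinfty a0) FB)
    (cvg_cst (m`!%:R / B))) as h.
  by move: h; rewrite mulrA divfK// divff// gt_eqF.
have : (fun x => (prod_count mu t (x `^ alpha) /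
    (x `^ alpha * ln (x `^ alpha) ^+ m) * (m`!%:R / B))%:E) @ +oo --> 1%E.
  by apply: cvg_EFin => //; near=> x.
apply: cvg_trans; apply: near_eq_cvg; near=> x.
have x1 : 1 < x by near: x; apply: nbhs_pinfty_gt; exact: num_real.
have x0 : 0 < x by exact: lt_trans x1.
have xa : x `^ alpha != 0 by rewrite gt_eqF// powR_gt0.
have lx : (alpha * ln x) ^+ m != 0.
  by rewrite expf_neq0// mulf_neq0 ?gt_eqF// ln_gt0.
rewrite prodE// -EFinM inver mulf_eq0 (gt_eqF Pc0)/=.
rewrite mulf_eq0 (negbTE xa)/= mulf_eq0 (negbTE lx)/=.
rewrite invr_eq0 (negbTE m0) -EFinM ln_powR; congr (_%:E).
move: lx xa m0; set L := _ ^+ m; set X := x `^ alpha; set f := _`!%:R.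
move=> lx xa m0.
by field; rewrite lx xa m0 gt_eqF.
Unshelve. all: by end_near. Qed.
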